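(* Let $(\mathfrak{A},\mathfrak{A}_0)$ be a Banach quasi *-algebra with unit $\mathbb{1}$ and let $\delta:\mathfrak{A}_0\to\mathfrak{A}$ be a qu*-derivation of $(\mathfrak{A},\mathfrak{A}_0)$. Suppose that there exists a representable and continuous linear functional $\omega$ on $\mathfrak{A}$ with $\omega(\delta(x))=0$ for all $x\in\mathfrak{A}_0$, and let $(\mathcal{H}_\omega,\pi_\omega,\lambda_\omega)$ be the GNS construction associated to $\omega$. Suppose that $\pi_\omega$ is a faithful *-representation of $(\mathfrak{A},\mathfrak{A}_0)$. Then there exists an element $H=H^\dagger$ of $\mathcal{L}^\dagger(\lambda_\omega(\mathfrak{A}_0),\mathcal{H}_\omega)$ such that $$\pi_\omega(\delta(x))=-i[H,\pi_\omega(x)]\quad\text{on } \lambda_\omega(\mathfrak{A}_0),\qquad \forall x\in\mathfrak{A}_0,$$ and $\delta$ is closable.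
   Context: **Quasi *-algebras.** A quasi *-algebra $(\mathfrak{A},\mathfrak{A}_0)$ is a pair consisting of a complex vector space $\mathfrak{A}$ and a *-algebra $\mathfrak{A}_0$ contained in $\mathfrak{A}$ as a subspace, such that: (i) $\mathfrak{A}$ carries an involution $a\mapsto a^*$ extending that of $\mathfrak{A}_0$; (ii) $\mathfrak{A}$ is a bimodule over $\mathfrak{A}_0$ and the module multiplications extend the multiplication of $\mathfrak{A}_0$; in particular $(xa)y=x(ay)$ and $a(xy)=(ax)y$ for $a\in\mathfrak{A}$, $x,y\in\mathfrak{A}_0$; (iii) $(ax)^*=x^*a^*$ for $a\in\mathfrak{A}$, $x\in\mathfrak{A}_0$. A unit is an element $\mathbb{1}\in\mathfrak{A}_0$ with $a\mathbb{1}=a=\mathbb{1}a$ for all $a\in\mathfrak{A}$. **Banach quasi *-algebras.** $(\mathfrak{A},\mathfrak{A}_0)$ is a Banach quasi *-algebra if $\mathfrak{A}$ is a Banach space under a norm $\|\cdot\|$ such that $\|a^*\|=\|a\|$ for all $a\in\mathfrak{A}$; $\mathfrak{A}_0$ is dense in $\mathfrak{A}$; and for every $x\in\mathfrak{A}_0$ the map $a\mapsto ax$ is continuous on $\mathfrak{A}$ (hence so is $a\mapsto xa$). **Operators.** For a dense subspace $\mathcal{D}$ of a Hilbert space $\mathcal{H}$, $\mathcal{L}^\dagger(\mathcal{D},\mathcal{H})$ is the set of all closable linear operators $X$ in $\mathcal{H}$ with domain exactly $\mathcal{D}$ and with $\mathcal{D}(X^* )\supset\mathcal{D}$. Its involution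 is $X^\dagger:=X^*\upharpoonright_{\mathcal{D}}$. The (partial) weak product is $X\square Y:=X^{\dagger *}Y$, defined whenever $Y\mathcal{D}\subset\mathcal{D}(X^{\dagger *})$ and $X^\dagger\mathcal{D}\subset\mathcal{D}(Y^* )$; in that case $X$ is called a left multiplier of $Y$. The commutator $[H,\pi_\omega(x)]$ is $H\square\pi_\omega(x)-\pi_\omega(x)\square H$, where $\pi_\omega(x)$ is regarded as an operator on the domain $\lambda_\omega(\mathfrak{A}_0)$; the equality asserts in particular that both weak products are defined. **Representations.** A *-representation of $(\mathfrak{A},\mathfrak{A}_0)$ is a linear map $\pi:\mathfrak{A}\to\mathcal{L}^\dagger(\mathcal{D}_\pi,\mathcal{H}_\pi)$, with $\mathcal{D}_\pi$ a dense subspace of a Hilbert space $\mathcal{H}_\pi$, such that $\pi(a^* )=\pi(a)^\dagger$ for $a\in\mathfrak{A}$, and, for $a\in\mathfrak{A}$, $x\in\mathfrak{A}_0$, $\pi(a)$ is a left multiplier of $\pi(x)$ and $\pi(a)\square\pi(x)=\pi(ax)$. In the unital case $\pi(\mathbb{1})$ is the identity of $\mathcal{D}_\pi$. It is faithful if $a\neq 0$ implies $\pi(a)\neq0$. It is cyclic with cyclic vector $\xi\in\mathcal{D}_\pi$ if $\pi(\mathfrak{A}_0)\xi$ is dense in $\mathcal{H}_\pi$. It is closed if $\mathcal{D}_\pi$ is complete in the graph topology, given by the seminorms $\eta\mapsto\|\pi(a)\eta\|$, $a\in\mathfrak{A}$. **Representable functionals and GNS construction.** A linear functional $\omega:\mathfrak{A}\to\mathbb{C}$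 is representable if: (L.1) $\omega(x^*x)\ge0$ for all $x\in\mathfrak{A}_0$; (L.2) $\omega(y^*a^*x)=\overline{\omega(x^*ay)}$ for all $x,y\in\mathfrak{A}_0$, $a\in\mathfrak{A}$; (L.3) for every $a\in\mathfrak{A}$ there is $\gamma_a>0$ with $|\omega(a^*x)|\le\gamma_a\,\omega(x^*x)^{1/2}$ for all $x\in\mathfrak{A}_0$. Continuity of $\omega$ is with respect to $\|\cdot\|$. For a representable $\omega$ on a unital quasi *-algebra there is a triple (the GNS construction), unique up to unitary equivalence, consisting of a Hilbert space $\mathcal{H}_\omega$, a closed cyclic *-representation $\pi_\omega$ of $(\mathfrak{A},\mathfrak{A}_0)$ in $\mathcal{H}_\omega$, and a linear map $\lambda_\omega:\mathfrak{A}\to\mathcal{H}_\omega$, such that $\lambda_\omega(\mathfrak{A}_0)$ is a dense subspace of $\mathcal{H}_\omega$ contained in the domain of $\pi_\omega$ (and dense in that domain for the graph topology), $\xi_\omega:=\lambda_\omega(\mathbb{1})$ is a cyclic vector, $\pi_\omega(a)\lambda_\omega(x)=\lambda_\omega(ax)$ for $a\in\mathfrak{A}$, $x\in\mathfrak{A}_0$, and $\omega(a)=\langle\pi_\omega(a)\xi_\omega|\xi_\omega\rangle$ for $a\in\mathfrak{A}$. **qu*-derivations.** A qu*-derivation of $(\mathfrak{A},\mathfrak{A}_0)$ is a linear map $\delta:\mathfrak{A}_0\to\mathfrak{A}$ with $\delta(x^* )=\delta(x)^*$ and $\delta(xy)=\delta(x)y+x\delta(y)$ for all $x,y\in\mathfrak{A}_0$.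 It is closable if, whenever $(x_n)\subset\mathfrak{A}_0$, $\|x_n\|\to0$ and $\|\delta(x_n)-w\|\to0$ for some $w\in\mathfrak{A}$, then $w=0$. *)

(* Defs.v *)
(* MathComp-Analysis, with complex scalars R[i] over R : realType.
   Norms are R[i]-valued (normedModType R[i]); in the partial order of R[i],
   0 <= z and 0 < z entail that z is real. *)
From HB Require Import structures.
From mathcomp Require Import all_boot all_order all_algebra.
From mathcomp Require Import complex.
From mathcomp Require Import all_classical all_reals all_analysis.
Import Order.TTheory GRing.Theory Num.Theory numFieldNormedType.Exports.

Set Implicit Arguments.
Unset Strict Implicit.
Unset Printing Implicit Defensive.

Local Open Scope classical_set_scope.
Local Open Scope ring_scope.

Section Subspaces.
Variable R : realType.

Definition subspace (V : lmodType R[i]) (D : set V) : Prop :=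
  D 0 /\ forall (c : R[i]) (u v : V), D u -> D v -> D (c *: u + v).

Definition linear_on (U V : lmodType R[i]) (D : set U) (f : U -> V) : Prop :=
  forall (c : R[i]) (u v : U), D u -> D v -> f (c *: u + v) = c *: f u + f v.

Definition closable_on (U V : normedModType R[i]) (D : set U) (f : U -> V)
    : Prop :=
  forall (u : nat -> U) (w : V), (forall n, D (u n)) ->
    u n @[n --> \oo] --> (0 : U) -> f (u n) @[n --> \oo] --> w -> w = 0.

End Subspaces.

(* qcore is the *-algebra A_0, as a subset of A.  The multiplication of A_0 and
   the two module multiplications are a single function qmul, which is
   meaningful only when at least one factor lies in qcore: all the axioms are
   restricted to that case.  That the module multiplications extend the
   multiplication of A_0 is thereby built in. *)
Record quasi_star_algebra (R : realType) (A : lmodType R[i]) := QuasiStarAlgebra {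
  qcore : set A ;
  qstar : A -> A ;
  qmul : A -> A -> A ;
  qcore_subspace : subspace qcore ;
  qcore_star : forall x, qcore x -> qcore (qstar x) ;
  qcore_mul : forall x y, qcore x -> qcore y -> qcore (qmul x y) ;
  qstarK : involutive qstar ;
  qstar_antilinear : forall (c : R[i]) (a b : A),
    qstar (c *: a + b) = Num.conj c *: qstar a + qstar b ;
  qmul_linearl : forall (c : R[i]) (a b x : A), qcore x ->
    qmul (c *: a + b) x = c *: qmul a x + qmul b x ;
  qmul_linearr : forall (c : R[i]) (x a b : A), qcore x ->
    qmul x (c *: a + b) = c *: qmul x a + qmul x b ;
  qmul_core_linearl : forall (c : R[i]) (x y a : A), qcore x -> qcore y ->
    qmul (c *: x + y) a = c *: qmul x a + qmul y a ;
  qmul_core_linearr : forall (c : R[i]) (a x y : A), qcore x -> qcore y ->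
    qmul a (c *: x + y) = c *: qmul a x + qmul a y ;
  qmulA_right : forall a x y, qcore x -> qcore y ->
    qmul a (qmul x y) = qmul (qmul a x) y ;
  qmulA_left : forall x y a, qcore x -> qcore y ->
    qmul (qmul x y) a = qmul x (qmul y a) ;
  qmulA_mid : forall x a y, qcore x -> qcore y ->
    qmul (qmul x a) y = qmul x (qmul a y) ;
  qstar_mul : forall a x, qcore x ->
    qstar (qmul a x) = qmul (qstar x) (qstar a)
}.

Definition is_unit (R : realType) (A : lmodType R[i])
    (Q : quasi_star_algebra A) (e : A) : Prop :=
  qcore Q e /\ forall a, qmul Q a e = a /\ qmul Q e a = a.

Definition banach_quasi_star_algebra (R : realType)
    (A : completeNormedModType R[i]) (Q : quasi_star_algebra A) : Prop :=
  [/\ forall a : A, `|qstar Q a| = `|a|,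
      dense (qcore Q)
    & forall x, qcore Q x -> continuous (fun a : A => qmul Q a x) ].

(* The inner product is linear in its first argument and conjugate-linear in
   the second. *)
Record hilbert_space (R : realType) := HilbertSpace {
  hilbert_sort :> completeNormedModType R[i] ;
  hilbert_dot : {dot hilbert_sort for Num.conj} ;
  hilbert_normE : forall x : hilbert_sort, `|x| ^+ 2 = hilbert_dot x x
}.

Definition inner (R : realType) (H : hilbert_space R) (x y : H) : R[i] :=
  hilbert_dot H x y.

(* A possibly unbounded operator; op_fun is irrelevant outside op_dom, so
   operators are compared with op_eq. *)
Record operator (R : realType) (H : hilbert_space R) := Operator {
  op_dom : set H ;
  op_fun :> H -> H
}.

Section Operators.
Variables (R : realType) (H : hilbert_space R).
Implicit Types (X Y : operator H) (D : set H).

Definition op_eq X Y : Prop :=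
  op_dom X = op_dom Y /\ forall xi, op_dom X xi -> X xi = Y xi.

Definition op_restrict X D : operator H := Operator (op_dom X `&` D) X.

Definition op_scale (c : R[i]) X : operator H :=
  Operator (op_dom X) (fun xi => c *: X xi).

Definition op_sub X Y : operator H :=
  Operator (op_dom X `&` op_dom Y) (fun xi => X xi - Y xi).

Definition op_comp X Y : operator H :=
  Operator [set xi | op_dom Y xi /\ op_dom X (Y xi)] (fun xi => X (Y xi)).

Definition adjoint_at X (eta zeta : H) : Prop :=
  forall xi, op_dom X xi -> inner (X xi) eta = inner xi zeta.

(* zeta is unique when op_dom X is dense, the only case of interest. *)
Definition adjoint X : operator H :=
  Operator [set eta | exists zeta, adjoint_at X eta zeta]
           (fun eta => xget 0 [set zeta | adjoint_at X eta zeta]).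

(* Membership in L^dagger(D, H), for a dense subspace D. *)
Definition Ldagger D X : Prop :=
  [/\ op_dom X = D,
      linear_on D X,
      closable_on D X
    & D `<=` op_dom (adjoint X) ].

Definition dagger X : operator H := op_restrict (adjoint X) (op_dom X).

Definition weak_product X Y : operator H := op_comp (adjoint (dagger X)) Y.

Definition left_multiplier X Y : Prop :=
  (forall xi, op_dom Y xi -> op_dom (adjoint (dagger X)) (Y xi)) /\
  (forall xi, op_dom X xi -> op_dom (adjoint Y) (dagger X xi)).

Definition commutator X Y : operator H :=
  op_sub (weak_product X Y) (weak_product Y X).

Definition commutator_defined X Y : Prop :=
  left_multiplier X Y /\ left_multiplier Y X.

End Operators.

Section Representations.
Variables (R : realType) (A : lmodType R[i]) (Q : quasi_star_algebra A).
Variable H : hilbert_space R.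
Implicit Types (D : set H) (pi : A -> operator H).

(* A *-representation, on the domain D, of a quasi *-algebra with unit e. *)
Record star_representation (e : A) D pi : Prop := StarRepresentation {
  rep_dom_subspace : subspace D ;
  rep_dom_dense : dense D ;
  rep_Ldagger : forall a, Ldagger D (pi a) ;
  rep_linear : forall (c : R[i]) (a b : A) xi, D xi ->
    pi (c *: a + b) xi = c *: pi a xi + pi b xi ;
  rep_star : forall a, op_eq (pi (qstar Q a)) (dagger (pi a)) ;
  rep_left_multiplier : forall a x, qcore Q x -> left_multiplier (pi a) (pi x) ;
  rep_mul : forall a x, qcore Q x ->
    op_eq (weak_product (pi a) (pi x)) (pi (qmul Q a x)) ;
  rep_unit : forall xi, D xi -> pi e xi = xi
}.

Definition faithful_rep D pi : Prop :=
  forall a, a <> 0 -> exists xi, D xi /\ pi a xi <> 0.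

Definition cyclic_vector D pi (xi : H) : Prop :=
  D xi /\ dense [set pi x xi | x in qcore Q].

(* Basic neighbourhoods of xi in the graph topology of D: finite intersections
   of balls of the seminorms eta |-> `|pi a eta|. *)
Definition graph_ball D pi (s : seq A) (eps : R[i]) (xi : H) : set H :=
  [set eta | D eta /\ forall a, a \in s -> `|pi a eta - pi a xi| < eps].

(* Completeness of D in the graph topology, which need not be metrizable:
   every Cauchy filter converges. *)
Definition closed_rep D pi : Prop :=
  forall F : set_system H, ProperFilter F ->
    (forall s eps, 0 < eps -> exists xi, D xi /\ F (graph_ball D pi s eps xi)) ->
    exists xi, D xi /\ forall s eps, 0 < eps -> F (graph_ball D pi s eps xi).

Definition graph_dense D pi (E : set H) : Prop :=
  forall xi s eps, D xi -> 0 < eps -> graph_ball D pi s eps xi `&` E !=set0.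

End Representations.

Definition representable (R : realType) (A : lmodType R[i])
    (Q : quasi_star_algebra A) (omega : {scalar A}) : Prop :=
  [/\ forall x, qcore Q x -> 0 <= omega (qmul Q (qstar Q x) x),
      forall x y a, qcore Q x -> qcore Q y ->
        omega (qmul Q (qmul Q (qstar Q y) (qstar Q a)) x) =
        Num.conj (omega (qmul Q (qmul Q (qstar Q x) a) y))
    & forall a, exists2 gamma : R[i], 0 < gamma & forall x, qcore Q x ->
        `|omega (qmul Q (qstar Q a) x)| <=
        gamma * sqrtC (omega (qmul Q (qstar Q x) x)) ].

Record gns_construction (R : realType) (A : lmodType R[i])
    (Q : quasi_star_algebra A) (e : A) (omega : {scalar A})
    (H : hilbert_space R) (D : set H) (pi : A -> operator H)
    (lambda : {linear A -> H}) : Prop := GnsConstruction {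
  gns_rep : star_representation Q e D pi ;
  gns_closed : closed_rep D pi ;
  gns_core_dense : dense (lambda @` qcore Q) ;
  gns_core_sub : lambda @` qcore Q `<=` D ;
  gns_core_graph_dense : graph_dense D pi (lambda @` qcore Q) ;
  gns_cyclic : cyclic_vector Q D pi (lambda e) ;
  gns_act : forall a x, qcore Q x -> pi a (lambda x) = lambda (qmul Q a x) ;
  gns_omega : forall a, omega a = inner (pi a (lambda e)) (lambda e)
}.

(* delta is a map qcore Q -> A; its values outside qcore Q are irrelevant. *)
Definition qu_star_derivation (R : realType) (A : lmodType R[i])
    (Q : quasi_star_algebra A) (delta : A -> A) : Prop :=
  [/\ linear_on (qcore Q) delta,
      forall x, qcore Q x -> delta (qstar Q x) = qstar Q (delta x)
    & forall x y, qcore Q x -> qcore Q y ->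
        delta (qmul Q x y) = qmul Q (delta x) y + qmul Q x (delta y) ].

(* Main.v *)
Require Import Defs.
From HB Require Import structures.
From mathcomp Require Import all_boot all_order all_algebra.
From mathcomp Require Import complex.
From mathcomp Require Import all_classical all_reals all_analysis.
From mathcomp Require Import ring.
Import Order.TTheory GRing.Theory Num.Theory numFieldNormedType.Exports.

Set Implicit Arguments.
Unset Strict Implicit.
Unset Printing Implicit Defensive.

Local Open Scope classical_set_scope.
Local Open Scope ring_scope.

(** Write A0 for the core of the quasi *-algebra and D0 for lambda(A0).

    The invariance of omega under delta, applied to delta(y^* x), says that
    lambda(x) |-> lambda(delta x) is skew-symmetric on D0
    ([lambda_delta_skew]); since D0 is dense, it is also well defined, although
    lambda need not be injective on A0 ([lambda_delta_eq]).  Hence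
    T : lambda(x) |-> i lambda(delta x) is a densely defined symmetric
    operator, thus closable.  The Leibniz rule gives
    T pi(x) lambda(y) - pi(x) T lambda(y) = i lambda(delta(x) y),
    where pi(x) acts on lambda(delta y), a vector that may lie outside D0,
    as the adjoint of its dagger; this adjoint sends lambda(a) to lambda(x a)
    for every a in A ([rep_restrict_dagger_adjoint_at]).

    For the closability of delta, let u_n -> 0 in A0 with delta(u_n) -> w.  By
    the Leibniz rule again,
    <lambda(delta(u_n) y), lambda(z)> =
      - <lambda(u_n y), lambda(delta z)>
      - conj <lambda(u_n^* z), lambda(delta y)>,
    and everything converges as soon as lambda is continuous from A to H.  In
    the limit lambda(w y) = pi(w) lambda(y) is orthogonal to D0, so pi(w)
    vanishes on D0, then on D because D0 is dense for the graph topology, and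
    w = 0 by faithfulness.

    The continuity of lambda ([lambda_continuous]) is the analytic core.  For y
    in A0 the functional a |-> <lambda(a), lambda(y)> = omega(y^* a) is
    continuous, as right multiplications, the involution and omega are.  Over
    the unit ball of D0 these functionals are pointwise bounded by the norm of
    lambda(a), so they are uniformly bounded on the Banach space A, and the
    density of D0 turns this into a bound of lambda. *)

(** * Uniform boundedness over the complex numbers *)

Section UniformBoundedness.
Variable R : realType.

Lemma complex_archimedean (x : R[i]) :
  x \is Num.real -> exists n : nat, x < n%:R.
Proof.
move=> /RRe_real <-; exists (Num.truncn (complex.Re x)).+1.
by rewrite -(rmorph_nat (real_complex R)) ltcR truncnS_gt.
Qed.

Lemma continuous_linear_bound (V W : normedModType R[i]) (f : {linear V -> W}) :
  continuous f -> exists2 C : R[i], 0 < C & forall x, `|f x| <= C * `|x|.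
Proof.
move=> /linear_bounded_continuous/linear_boundedP [M [Mreal fM]].
exists (`|M| + 1) => [|x]; first by rewrite ltr_wpDl.
apply: (fM (`|M| + 1)).
by rewrite (le_lt_trans (real_ler_norm Mreal))// ltrDl.
Qed.

Lemma linear_bound_continuous (V W : normedModType R[i]) (f : {linear V -> W})
    (C : R[i]) :
  C \is Num.real -> (forall x, `|f x| <= C * `|x|) -> continuous f.
Proof.
move=> Creal fC; apply/linear_bounded_continuous/linear_boundedP.
exists C; split=> // r Cr x.
by rewrite (le_trans (fC x))// ler_wpM2r// ltW.
Qed.

(** A linear map that is large somewhere is large on a small closed ball in
    any given ball: at one of y + z and y - z it is at least as large as at z,
    and continuity gives the radius.  The bound on r' * n makes the radii of an
    iteration tend to 0. *)
Lemma gliding_step (V W : normedModType R[i]) (f : {linear V -> W}) (n : nat)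
    (y : V) (r : R[i]) :
  0 < r -> continuous f ->
  (exists x, n.+1%:R * (2 / r) * `|x| < `|f x|) ->
  exists y' r', [/\ 0 < r', r' <= r / 2, r' * n%:R <= 1, `|y' - y| <= r / 2
    & forall v, `|v - y'| <= r' -> n%:R < `|f v|].
Proof.
move=> r0 /continuous_linear_bound[C C0 fC] [x fx].
have x0 : 0 < `|x|.
  rewrite normr_gt0; apply: contraTN isT => /eqP xE.
  by move: fx; rewrite xE linear0 !normr0 mulr0 ltxx.
pose z := (r / 2 / `|x|) *: x.
have zE : `|z| = r / 2.
  rewrite normrZ ger0_norm ?divfK ?gt_eqF// !divr_ge0 ?ltW//.
have fz : n.+1%:R < `|f z|.
  rewrite linearZ normrZ ger0_norm; last by rewrite !divr_ge0 ?ltW.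
  rewrite -(ltr_pM2l (_ : 0 < 2 / r * `|x|)); last by rewrite mulr_gt0 ?divr_gt0.
  have -> : 2 / r * `|x| * (r / 2 / `|x| * `|f x|) = `|f x|.
    by field; rewrite !gt_eqF.
  by rewrite mulrC mulrA.
(* f z is half the difference of the values of f at y + z and y - z *)
have [y' yE fy'] : exists2 y', `|y' - y| = r / 2 & n.+1%:R < `|f y'|.
  have [h|h] : n.+1%:R < `|f (y + z)| \/ n.+1%:R < `|f (y - z)|.
    have [?|le1] := real_ltP (realn _ _) (normr_real (f (y + z))); first by left.
    right; rewrite real_ltNge ?realn ?normr_real//; apply/negP => le2.
    have : `|f z + f z| <= n.+1%:R + n.+1%:R.
      have -> : f z + f z = f (y + z) - f (y - z).
        by rewrite linearD linearB opprB [RHS]addrC subrKA.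
      by rewrite (le_trans (ler_normB _ _))// lerD.
    rewrite -!mulr2n normrMn lerMn2r /= => /(lt_le_trans fz).
    by rewrite ltxx.
  - by exists (y + z) => //; rewrite addrAC subrr add0r.
  - by exists (y - z) => //; rewrite addrAC subrr add0r normrN.
(* the three terms of d give r / d <= r / 2, C * (r / d) <= 1, n * (r / d) <= 1 *)
pose d := 2 + C * r + n%:R * r.
have Cr0 : 0 <= C * r by rewrite mulr_ge0// ltW.
have nr0 : 0 <= n%:R * r by rewrite mulr_ge0// ltW.
have d2 : 2 <= d by rewrite /d -addrA lerDl addr_ge0//.
have d0 : 0 < d by rewrite (lt_le_trans _ d2).
exists y', (r / d); split=> //.
- by rewrite divr_gt0.
- by rewrite ler_pM2l// lef_pV2 ?posrE//.
- rewrite mulrAC ler_pdivrMr// mul1r mulrC /d lerDr addr_ge0//.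
- by rewrite yE.
- move=> v vy'.
  have h : `|f (v - y')| <= 1.
    rewrite (le_trans (fC _))// (le_trans (ler_wpM2l (ltW C0) vy'))//.
    rewrite mulrA ler_pdivrMr// mul1r /d addrAC lerDr addr_ge0//.
  have : n.+1%:R < `|f v| + 1.
    rewrite (lt_le_trans fy')// -[y'](subrKC v) linearD (le_trans (ler_normD _ _))//.
    by rewrite lerD2l -opprB linearN normrN.
  by rewrite -natr1 ltrD2r.
Qed.

(** If the family is not uniformly bounded, nested closed balls can be chosen
    so that on the n-th one some member exceeds n; by completeness they have a
    common point, where the family is not bounded. *)
Theorem uniform_boundedness (V : completeNormedModType R[i])
    (W : normedModType R[i]) (I : Type) (P : set I) (f : I -> {linear V -> W}) :
  (forall i, P i -> continuous (f i)) ->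
  (forall x, exists2 M, M \is Num.real & forall i, P i -> `|f i x| <= M) ->
  exists2 M : R[i], 0 <= M & forall i, P i -> forall x, `|f i x| <= M * `|x|.
Proof.
move=> fcont fbnd; apply: contrapT => unbounded.
have big (M : R[i]) : 0 <= M -> exists2 i, P i & exists x, M * `|x| < `|f i x|.
  move=> M0; apply: contrapT => small; apply: unbounded; exists M => // i Pi x.
  rewrite real_leNgt ?realM ?normr_real ?ger0_real//; apply/negP => fx.
  by apply: small; exists i => //; exists x.
have step (a : nat * (V * {r : R[i] | 0 < r})) :
    exists b : V * {r : R[i] | 0 < r},
    [/\ sval b.2 <= sval a.2.2 / 2, sval b.2 * a.1%:R <= 1,
        `|b.1 - a.2.1| <= sval a.2.2 / 2
      & exists2 i, P i & forall v, `|v - b.1| <= sval b.2 -> a.1%:R < `|f i v|].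
  case: a => n [y [r r0]] /=.
  have [|i Pi fi] := big (n.+1%:R * (2 / r)).
    by rewrite mulr_ge0// ltW// divr_gt0.
  have [y' [r' [r'0 r'r r'n y'y fv]]] := gliding_step y r0 (fcont i Pi) fi.
  by exists (y', exist _ r' r'0); split=> //; exists i.
have [g gP] := choice step.
pose fix b n : V * {r : R[i] | 0 < r} :=
  if n is m.+1 then g (m, b m) else (0, exist _ 1 ltr01).
pose y n := (b n).1; pose r n : R[i] := sval (b n).2.
have r_gt0 n : 0 < r n by rewrite /r; case: (b n).2.
have bP n := gP (n, b n).
have nested m n : `|y (n + m)%N - y n| + r (n + m)%N <= r n.
  elim: m => [|m]; first by rewrite addn0 subrr normr0 add0r.
  rewrite addnS; apply: le_trans.
  have [h1 _ h2 _] := bP (n + m)%N.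
  rewrite -[y _ - y n](subrKA (y (n + m)%N)).
  rewrite (le_trans (lerD (ler_normD _ _) h1))// addrAC addrC lerD2l.
  by rewrite (le_trans (lerD h2 (lexx _)))// -splitr.
have ydist m n : (n <= m)%N -> `|y m - y n| <= r n.
  move=> nm; rewrite -(subnKC nm) (le_trans _ (nested (m - n)%N n))//.
  by rewrite lerDl ltW.
have : cvg (y @ \oo).
  apply: cauchy_cvg; apply: cauchy_exP => eps eps0.
  have /gtr0_real/complex_archimedean[n ltn] : 0 < eps^-1 by rewrite invr_gt0.
  have n0 : 0 < n%:R :> R[i] by rewrite (lt_trans _ ltn)// invr_gt0.
  exists (y n.+1), n.+1 => // m /= nm.
  rewrite -ball_normE /= distrC (le_lt_trans (ydist _ _ nm))//.
  have [_ + _ _] := bP n; rewrite -/(r n.+1) -ler_pdivlMr// => /le_lt_trans.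
  by apply; rewrite mul1r -[eps]invrK ltf_pV2 ?posrE ?invr_gt0.
rewrite cvg_ex => -[l yl].
have ldist n : `|l - y n| <= r n.
  apply/ler_addgt0Pr => eps eps0.
  have [m _ yml] := (cvgrPdist_lt _ _).1 yl _ eps0.
  have /= h := yml (maxn m n) (leq_maxl _ _).
  rewrite -(subrKA (y (maxn m n))) (le_trans (ler_normD _ _))// addrC lerD//.
    by apply: ydist; rewrite leq_maxr.
  exact: ltW.
have [M Mreal fM] := fbnd l.
have [n Mn] := complex_archimedean Mreal.
have [_ _ _ [i Pi /(_ l (ldist n.+1)) fl]] := bP n.
by have := lt_trans (lt_le_trans fl (fM i Pi)) Mn; rewrite ltxx.
Qed.

End UniformBoundedness.

(** * Inner products and density *)

Section InnerProduct.
Variables (R : realType) (H : hilbert_space R).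
Implicit Types (x y z : H) (D : set H).

Lemma innerC x y : inner x y = (inner y x)^*.
Proof. by rewrite /inner hermC expr0 mul1r. Qed.

Lemma innerDl x y z : inner (x + y) z = inner x z + inner y z.
Proof. exact: linearDl. Qed.

Lemma innerZl (c : R[i]) x z : inner (c *: x) z = c * inner x z.
Proof. exact: linearZl_LR. Qed.

Lemma innerBl x y z : inner (x - y) z = inner x z - inner y z.
Proof. exact: linearBl. Qed.

Lemma inner0l z : inner 0 z = 0.
Proof. exact: linear0l. Qed.

Lemma innerZr (c : R[i]) x z : inner z (c *: x) = c^* * inner z x.
Proof. by rewrite innerC innerZl rmorphM/= -innerC. Qed.

Lemma innerBr x y z : inner z (x - y) = inner z x - inner z y.
Proof. by rewrite innerC innerBl rmorphB/= -!innerC. Qed.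

Lemma innerxx x : inner x x = `|x| ^+ 2.
Proof. by rewrite hilbert_normE. Qed.

Lemma cauchy_schwarz x y : `|inner x y| <= `|x| * `|y|.
Proof.
have [->|y0] := eqVneq y 0.
  by rewrite innerC inner0l conjC0 !normr0 mulr0.
have ny0 : 0 < `|y| by rewrite normr_gt0.
(* u is the component of x orthogonal to y *)
pose c := inner x y / `|y| ^+ 2; pose u := x - c *: y.
have uy : inner u y = 0.
  by rewrite innerBl innerZl innerxx divfK ?subrr// expf_neq0// gt_eqF.
have ucy : inner u (c *: y) = 0 by rewrite innerZr uy mulr0.
have : inner (u + c *: y) (u + c *: y) = inner u u + inner (c *: y) (c *: y).
  exact: hnormDd ucy.
rewrite subrK !innerxx normrZ => xE.
have : (`|c| * `|y|) ^+ 2 <= `|x| ^+ 2 by rewrite xE lerDr exprn_ge0.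
rewrite ler_sqr ?nnegrE ?mulr_ge0// => cx.
rewrite (le_trans _ (ler_wpM2r (ltW ny0) cx))// /c normrM normfV.
rewrite (ger0_norm (exprn_ge0 2 (normr_ge0 y))).
by rewrite -mulrA -expr2 divfK// expf_neq0// gt_eqF.
Qed.

Definition inner_with z (x : H) : R[i]^o := inner x z.

Lemma inner_with_linear z : linear (inner_with z).
Proof. by move=> c x y; rewrite /inner_with innerDl innerZl. Qed.

HB.instance Definition _ z :=
  GRing.isLinear.Build R[i] H R[i]^o _ (inner_with z) (inner_with_linear z).

Lemma inner_with_continuous z : continuous (inner_with z).
Proof.
apply: (@linear_bound_continuous _ _ _ (inner_with z) `|z|).
  exact: normr_real.
by move=> x; rewrite mulrC; exact: cauchy_schwarz.
Qed.

Lemma inner_cvg z (u : nat -> H) (l : H) :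
  u n @[n --> \oo] --> l ->
  inner (u n) z @[n --> \oo] --> (inner l z : R[i]^o).
Proof. by move=> ul; exact: (cvg_comp _ _ ul (@inner_with_continuous z l)). Qed.

(** The bound extends from D to xi = h, where it reads
    [`|h| ^+ 2 <= C * `|h|]. *)
Lemma dense_inner_bound D (h : H) (C : R[i]) : dense D -> 0 <= C ->
  (forall xi, D xi -> `|inner h xi| <= C * `|xi|) -> `|h| <= C.
Proof.
move=> dD C0 hC.
have [->|h0] := eqVneq h 0; first by rewrite normr0.
have nh : 0 < `|h| by rewrite normr_gt0.
rewrite -(ler_pM2r nh); apply/ler_addgt0Pr => e e0.
have d0 : 0 < e / (`|h| + C) by rewrite divr_gt0// ltr_pwDl.
have [|xi [hxi Dxi]] := dD (ball h (e / (`|h| + C))) _ (ball_open _ _).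
  by exists h; exact: ballxx.
move: hxi; rewrite -ball_normE /= => hxi.
have -> : `|h| * `|h| = `|inner h (h - xi) + inner h xi|.
  by rewrite innerBr subrK innerxx ger0_norm ?exprn_ge0// expr2.
rewrite (le_trans (ler_normD _ _))//.
rewrite (le_trans (lerD (cauchy_schwarz _ _) (hC _ Dxi)))//.
have xiE : `|xi| <= `|h| + `|h - xi|.
  by rewrite -[X in `|X|](subKr h) ler_normB.
rewrite (le_trans (lerD (lexx _) (ler_wpM2l C0 xiE)))//.
rewrite mulrDr addrCA lerD2l -mulrDl mulrC.
by rewrite -ler_pdivlMr ?ltW// ltr_pwDl.
Qed.

Lemma dense_orthogonal D (h : H) :
  dense D -> (forall xi, D xi -> inner h xi = 0) -> h = 0.
Proof.
move=> dD hD; apply/eqP; rewrite -normr_le0.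
by apply: (dense_inner_bound dD) => // xi /hD ->; rewrite normr0 mul0r.
Qed.

End InnerProduct.

(** * Adjoints of densely defined operators *)

Section Adjoints.
Variables (R : realType) (H : hilbert_space R).
Implicit Types (X : operator H) (D : set H) (xi eta zeta : H).

Lemma adjoint_atP X eta :
  op_dom (adjoint X) eta -> adjoint_at X eta (adjoint X eta).
Proof. exact: xgetPex. Qed.

Lemma adjoint_eq X eta zeta :
  dense (op_dom X) -> adjoint_at X eta zeta -> adjoint X eta = zeta.
Proof.
move=> dX h; have h' := adjoint_atP (ex_intro _ zeta h).
apply/eqP; rewrite -subr_eq0; apply/eqP/(dense_orthogonal dX) => xi Xxi.
by rewrite innerC innerBr -(h _ Xxi) -(h' _ Xxi) subrr conjC0.
Qed.

Lemma adjoint_atZ (c : R[i]) X eta zeta :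
  adjoint_at X eta zeta -> adjoint_at X (c *: eta) (c *: zeta).
Proof. by move=> h xi Xxi; rewrite !innerZr h. Qed.

Lemma dagger_eq D X (Y : H -> H) : dense D -> op_dom X = D ->
  (forall eta, D eta -> adjoint_at X eta (Y eta)) ->
  op_dom (dagger X) = D /\ forall eta, D eta -> dagger X eta = Y eta.
Proof.
move=> dD domX adjX; split=> [|eta /adjX]; last first.
  by apply: adjoint_eq; rewrite domX.
rewrite /= domX; apply/seteqP; split=> [eta []//|eta Deta].
by split=> //; exists (Y eta); exact: adjX.
Qed.

(** Closability comes from symmetry: if u_n -> 0 and X u_n -> w, then
    <X u_n, eta> = <u_n, X eta> tends to both <w, eta> and 0. *)
Lemma symmetric_Ldagger D X : dense D -> op_dom X = D -> linear_on D X ->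
  (forall eta, D eta -> adjoint_at X eta (X eta)) ->
  Ldagger D X /\ op_eq X (dagger X).
Proof.
move=> dD domX linX symX; split; last first.
  have [domdX dXE] := dagger_eq dD domX symX.
  by split=> [|xi]; rewrite domX// => /dXE.
split=> // [u w Du u0 Xw|eta /symX adjX]; last by exists (X eta).
apply: (dense_orthogonal dD) => eta Deta.
have h1 := inner_cvg (z := eta) Xw.
have h2 := inner_cvg (z := X eta) u0.
rewrite inner0l in h2.
have symE : (fun n => inner (X (u n)) eta) = (fun n => inner (u n) (X eta)).
  by apply/funext => n; apply: symX => //; rewrite domX.
rewrite symE in h1.
exact: (cvg_unique (@norm_hausdorff _ R[i]^o) h1 h2).
Qed.

End Adjoints.

(** * The GNS vectors *)

Section GnsCommutator.
Variables (R : realType) (A : completeNormedModType R[i]).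
Variables (Q : quasi_star_algebra A) (e : A) (omega : {scalar A}).
Variables (H : hilbert_space R) (D : set H) (pi : A -> operator H).
Variable lambda : {linear A -> H}.
Hypothesis unitQ : is_unit Q e.
Hypothesis gns : gns_construction Q e omega D pi lambda.

Local Notation A0 := (qcore Q).
Local Notation D0 := (lambda @` qcore Q).
Local Notation "a '^s'" := (qstar Q a) (at level 2, format "a ^s").
Local Infix "**" := (qmul Q) (at level 40, left associativity).

Hypothesis banach : banach_quasi_star_algebra Q.
Hypothesis omega_continuous : continuous (omega : A -> R[i]^o).

Let rep := gns_rep gns.
Let D0_dense : dense D0 := gns_core_dense gns.
Let core_e : A0 e := unitQ.1.
Let coreS x : A0 x -> A0 (x^s) := @qcore_star _ _ Q x.
Let coreM x y : A0 x -> A0 y -> A0 (x ** y) := @qcore_mul _ _ Q x y.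

Lemma core_image x : A0 x -> D0 (lambda x).
Proof. by exists x. Qed.

Lemma core_image_dom x : A0 x -> D (lambda x).
Proof. by move=> /core_image; exact: (gns_core_sub gns). Qed.

Lemma qstar_mulr x a : A0 x -> (x ** a)^s = a^s ** x^s.
Proof.
move=> x0; rewrite -[in LHS](qstarK Q a) -[in LHS](qstarK Q x).
by rewrite -qstar_mul ?qstarK//; exact: coreS.
Qed.

Lemma rep_adjoint_at a y : A0 y -> adjoint_at (pi a) (lambda y) (lambda (a^s ** y)).
Proof.
move=> y0; rewrite -(gns_act gns)//.
have [_ _ _ subE] := rep_Ldagger rep a.
have [_ ->] := rep_star rep a; first exact/adjoint_atP/subE/core_image_dom.
by have [-> _ _ _] := rep_Ldagger rep a^s; exact: core_image_dom.
Qed.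

Lemma inner_lambda_mul a x y : A0 x -> A0 y ->
  inner (lambda (a ** x)) (lambda y) = inner (lambda x) (lambda (a^s ** y)).
Proof.
move=> x0 y0; rewrite -(gns_act gns a)//; apply: rep_adjoint_at => //.
by have [-> _ _ _] := rep_Ldagger rep a; exact: core_image_dom.
Qed.

(** A representation is multiplicative only when the right factor is in the
    core, and a need not be: the computation goes through the star a^* y of
    y^* a, where the right factor is y. *)
Lemma inner_lambdar a y :
  A0 y -> inner (lambda a) (lambda y) = omega (y^s ** a).
Proof.
move=> y0; have mul_e b : b ** e = b := (unitQ.2 b).1.
rewrite (gns_omega gns) (gns_act gns)// inner_lambda_mul//.
rewrite qstar_mulr ?qstarK ?mul_e; last exact: coreS.
by rewrite -inner_lambda_mul// mul_e.
Qed.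

Lemma inner_lambdal a y :
  A0 y -> inner (lambda y) (lambda a) = omega (a^s ** y).
Proof.
move=> y0; have mul_e b : b ** e = b := (unitQ.2 b).1.
rewrite (gns_omega gns) (gns_act gns)// mul_e inner_lambda_mul//.
by rewrite qstarK mul_e.
Qed.

(** Left multiplication by a core element is adjoint to that by its star even
    against vectors lambda(a) with a outside the core; this is what makes weak
    products with pi(x) computable. *)
Lemma inner_lambda_core_mul x a z : A0 x -> A0 z ->
  inner (lambda (x ** a)) (lambda z) = inner (lambda a) (lambda (x^s ** z)).
Proof.
move=> x0 z0; rewrite !inner_lambdar//; last by apply: coreM => //; exact: coreS.
rewrite -qmulA_left//; last exact: coreS.
by rewrite qstar_mul// qstarK.
Qed.

Lemma qstarB a b : (a - b)^s = a^s - b^s.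
Proof.
have := qstar_antilinear Q (-1) b a.
by rewrite rmorphN1 !scaleN1r addrC => ->; rewrite addrC.
Qed.

Lemma qstar_continuous : continuous (qstar Q).
Proof.
have [normS _ _] := banach.
move=> a; apply/cvgrPdist_lt => eps eps0; near=> b.
by rewrite -qstarB normS; near: b; apply: cvgr_dist_lt => //; exact: cvg_id.
Unshelve. all: by end_near. Qed.

(** Uniform boundedness applied to a |-> <lambda(a), z>, for z in the unit ball
    of the dense subspace D0. *)
Lemma lambda_continuous : continuous lambda.
Proof.
have [_ _ mul_cont] := banach.
pose f z : {linear A -> R[i]^o} := inner_with z \o lambda.
have [||M M0 fM] := @uniform_boundedness _ A R[i]^o H
    [set z | D0 z /\ `|z| <= 1] f.
- move=> _ [[y y0 <-] _].
  have -> : (f (lambda y) : A -> R[i]^o) =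
      omega \o qstar Q \o (fun a => a ** y) \o qstar Q.
    apply/funext => a /=.
    by rewrite /inner_with inner_lambdar// qstar_mul// qstarK.
  move=> a; apply: continuous_comp; first exact: qstar_continuous.
  apply: continuous_comp; first exact: mul_cont.
  by apply: continuous_comp; [exact: qstar_continuous|exact: omega_continuous].
- move=> a; exists `|lambda a|; first exact: normr_real.
  move=> z [_ z1]; rewrite (le_trans (cauchy_schwarz _ _))//.
  by rewrite ler_piMr.
apply: (linear_bound_continuous (ger0_real M0)) => a.
apply: (dense_inner_bound D0_dense) => [|_ [y y0 <-]]; first by rewrite mulr_ge0.
have [->|ly0] := eqVneq (lambda y) 0.
  by rewrite innerC inner0l conjC0 !normr0 mulr0.
have ny : 0 < `|lambda y| by rewrite normr_gt0.
have := fM (`|lambda y|^-1 *: lambda y) _ a.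
rewrite /= /inner_with innerZr normrM norm_conjC normfV normr_id => fMy.
rewrite -ler_pdivrMr// mulrC; apply: fMy; split.
  exists (`|lambda y|^-1 *: y); last by rewrite linearZ.
  by have [A00 /(_ `|lambda y|^-1 y 0 y0 A00)] := qcore_subspace Q; rewrite addr0.
by rewrite normrZ normfV normr_id mulVf// gt_eqF.
Qed.


(** * The symmetric operator implementing the derivation *)

Section Derivation.
Variable delta : A -> A.
Hypothesis derivation : qu_star_derivation Q delta.
Hypothesis omega_delta : forall x, A0 x -> omega (delta x) = 0.

(** This is omega(delta(y^* x)) = 0 expanded by the Leibniz rule. *)
Lemma lambda_delta_skew x y : A0 x -> A0 y ->
  inner (lambda (delta x)) (lambda y) = - inner (lambda x) (lambda (delta y)).
Proof.
have [_ deltaS deltaM] := derivation.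
move=> x0 y0; have yS := coreS y0.
have /eqP := omega_delta (coreM yS x0).
rewrite deltaM// deltaS// linearD addr_eq0 => /eqP dyx.
by rewrite inner_lambdar// inner_lambdal// dyx opprK.
Qed.

(** By skew-symmetry, lambda(delta x) is determined on the dense subspace D0 by
    lambda(x). *)
Lemma lambda_delta_eq x y : A0 x -> A0 y -> lambda x = lambda y ->
  lambda (delta x) = lambda (delta y).
Proof.
move=> x0 y0 xy; apply/eqP; rewrite -subr_eq0; apply/eqP.
apply: (dense_orthogonal D0_dense) => _ [z z0 <-].
by rewrite innerBl !lambda_delta_skew// xy subrr.
Qed.

(** A vector of D0 may have several preimages; [lambda_delta_eq] makes the
    choice among them immaterial. *)
Definition hamiltonian : operator H :=
  Operator D0
    (fun xi => 'i *: lambda (delta (xget 0 [set x | A0 x /\ lambda x = xi]))).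

Lemma hamiltonianE y : A0 y -> hamiltonian (lambda y) = 'i *: lambda (delta y).
Proof.
move=> y0 /=; set P := [set x | _].
have [x0 xy] : P (xget 0 P) by apply: xgetPex; exists y.
by rewrite (lambda_delta_eq x0 y0 xy).
Qed.

Lemma hamiltonian_linear : linear_on D0 hamiltonian.
Proof.
have [deltaL _ _] := derivation.
move=> c _ _ [x x0 <-] [y y0 <-].
have [_ /(_ c x y x0 y0) xy0] := qcore_subspace Q.
rewrite -linearP !hamiltonianE// deltaL// linearP scalerDr !scalerA.
by rewrite mulrC.
Qed.

(** The factor i turns the skew-symmetry of lambda o delta into symmetry. *)
Lemma hamiltonian_symmetric eta :
  D0 eta -> adjoint_at hamiltonian eta (hamiltonian eta).
Proof.
move=> [y y0 <-] _ [x x0 <-]; rewrite !hamiltonianE//.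
by rewrite innerZl innerZr lambda_delta_skew// conjCi mulrN mulNr.
Qed.

Lemma hamiltonian_Ldagger :
  Ldagger D0 hamiltonian /\ op_eq hamiltonian (dagger hamiltonian).
Proof.
by apply: symmetric_Ldagger hamiltonian_linear hamiltonian_symmetric.
Qed.

Lemma rep_restrict x : A0 x ->
  op_dom (op_restrict (pi x) D0) = D0 /\
  forall y, A0 y -> op_restrict (pi x) D0 (lambda y) = lambda (x ** y).
Proof.
move=> x0; split=> [/=|y y0]; last exact: (gns_act gns).
have [-> _ _ _] := rep_Ldagger rep x.
by apply/setIidPr; exact: (gns_core_sub gns).
Qed.

Lemma rep_restrict_adjoint_at x a : A0 x ->
  adjoint_at (op_restrict (pi x) D0) (lambda a) (lambda (x^s ** a)).
Proof.
move=> x0 xi; have [-> xE] := rep_restrict x0; case=> z z0 <-.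
rewrite xE// innerC [RHS]innerC inner_lambda_core_mul ?qstarK//.
exact: coreS.
Qed.

Lemma rep_restrict_dagger x : A0 x ->
  op_dom (dagger (op_restrict (pi x) D0)) = D0 /\
  forall y, A0 y ->
    dagger (op_restrict (pi x) D0) (lambda y) = lambda (x^s ** y).
Proof.
move=> x0; have [domX _] := rep_restrict x0.
have [|-> dX] := @dagger_eq _ _ _ _ (pi x^s) D0_dense domX.
  by move=> _ [y y0 <-]; rewrite (gns_act gns)//; exact: rep_restrict_adjoint_at.
by split=> // y y0; rewrite dX ?(gns_act gns)//; exact: core_image.
Qed.

(** The vectors T lambda(y) = i lambda(delta y) need not be in the domain of
    pi(x); this says how the weak product extends pi(x) to them. *)
Lemma rep_restrict_dagger_adjoint_at x a : A0 x ->
  adjoint_at (dagger (op_restrict (pi x) D0)) (lambda a) (lambda (x ** a)).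
Proof.
move=> x0 xi; have [-> dXE] := rep_restrict_dagger x0; case=> z z0 <-.
by rewrite dXE// innerC [RHS]innerC inner_lambda_core_mul.
Qed.

Lemma hamiltonian_dagger : op_dom (dagger hamiltonian) = D0 /\
  forall eta, D0 eta -> dagger hamiltonian eta = hamiltonian eta.
Proof. exact: dagger_eq D0_dense _ hamiltonian_symmetric. Qed.

Lemma hamiltonian_dagger_adjoint_at eta : D0 eta ->
  adjoint_at (dagger hamiltonian) eta (hamiltonian eta).
Proof.
move=> D0eta xi.
have [-> dTE] := hamiltonian_dagger.
by move=> D0xi; rewrite dTE//; exact: hamiltonian_symmetric.
Qed.

Lemma hamiltonian_commutator_defined x : A0 x ->
  commutator_defined hamiltonian (op_restrict (pi x) D0).
Proof.
move=> x0; have [domX XE] := rep_restrict x0.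
have [domdT dTE] := hamiltonian_dagger.
have [domdX dXE] := rep_restrict_dagger x0.
split; split; rewrite ?domX => _ [y y0 <-].
- rewrite XE//; exists (hamiltonian (lambda (x ** y))).
  apply: hamiltonian_dagger_adjoint_at.
  by apply: core_image; exact: coreM.
- rewrite dTE ?hamiltonianE//.
  by eexists; apply: adjoint_atZ; exact: rep_restrict_adjoint_at.
- rewrite hamiltonianE//.
  by eexists; apply: adjoint_atZ; exact: rep_restrict_dagger_adjoint_at.
- rewrite dXE//; exists (hamiltonian (lambda (x^s ** y))).
  apply: hamiltonian_symmetric; apply: core_image.
  by apply: coreM => //; exact: coreS.
Qed.

(** On lambda(y), the Leibniz rule leaves
    i lambda(delta(x y)) - i lambda(x delta(y)) = i lambda(delta(x) y). *)
Lemma hamiltonian_commutator x : A0 x ->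
  op_eq (op_restrict (pi (delta x)) D0)
        (op_scale (- 'i) (commutator hamiltonian (op_restrict (pi x) D0))).
Proof.
have [_ _ deltaM] := derivation.
move=> x0; have [domX XE] := rep_restrict x0.
have [domdT _] := hamiltonian_dagger.
have [domdX _] := rep_restrict_dagger x0.
have [[mulTX _] [mulXT _]] := hamiltonian_commutator_defined x0.
have [domdelta _ _ _] := rep_Ldagger rep (delta x).
have domE : op_dom (pi (delta x)) `&` D0 = D0.
  by rewrite domdelta; apply/setIidPr; exact: (gns_core_sub gns).
split=> [|xi].
  rewrite [LHS]domE; apply/seteqP; split=> [xi D0xi|xi [_ []]//].
  by split; split; rewrite ?domX//; [apply: mulTX; rewrite domX|apply: mulXT].
rewrite [op_dom _]domE => -[y y0 <-].
have TX : adjoint (dagger hamiltonian) (op_restrict (pi x) D0 (lambda y)) =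
          'i *: lambda (delta (x ** y)).
  rewrite XE// -hamiltonianE; last exact: coreM.
  apply: adjoint_eq; first by rewrite domdT.
  by apply: hamiltonian_dagger_adjoint_at; apply: core_image; exact: coreM.
have XT : adjoint (dagger (op_restrict (pi x) D0)) (hamiltonian (lambda y)) =
          'i *: lambda (x ** delta y).
  rewrite hamiltonianE//; apply: adjoint_eq; first by rewrite domdX.
  by apply: adjoint_atZ; exact: rep_restrict_dagger_adjoint_at.
have -> : op_restrict (pi (delta x)) D0 (lambda y) = lambda (delta x ** y).
  exact: (gns_act gns).
rewrite -[op_scale _ _ _]/(- 'i *:
  (adjoint (dagger hamiltonian) (op_restrict (pi x) D0 (lambda y)) -
   adjoint (dagger (op_restrict (pi x) D0)) (hamiltonian (lambda y)))).
rewrite TX XT -scalerBr -linearB deltaM// addrK scalerA.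
by rewrite mulNr -expr2 sqrCi opprK scale1r.
Qed.

(** * Closability of the derivation *)

(** The matrix coefficients of pi(delta(u_n)) between vectors of D0 tend to 0,
    because the Leibniz rule moves delta away from u_n. *)
Lemma derivation_closable : faithful_rep D pi -> closable_on A0 delta.
Proof.
move=> faithful u w u_core u0 du_w.
have [_ _ deltaM] := derivation.
have [_ _ mul_cont] := banach.
have lambda_cvg (v : nat -> A) (l : A) y : A0 y -> v n @[n --> \oo] --> l ->
    lambda (v n ** y) @[n --> \oo] --> lambda (l ** y).
  move=> y0 vl; have vyl := cvg_comp _ _ vl (mul_cont y y0 l).
  exact: (cvg_comp _ _ vyl (@lambda_continuous (l ** y))).
have mul0 y : A0 y -> 0 ** y = 0.
  move=> y0; have := qmul_linearl (-1) 0 0 y0.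
  by rewrite scaleN1r oppr0 addr0 scaleN1r addNr.
have lambda_cvg0 (v : nat -> A) y : A0 y -> v n @[n --> \oo] --> (0 : A) ->
    lambda (v n ** y) @[n --> \oo] --> (0 : H).
  by move=> y0 /(lambda_cvg _ _ _ y0); rewrite mul0// linear0.
have us0 : (u n)^s @[n --> \oo] --> (0 : A).
  have star0 : (0 : A)^s = 0 by have := qstarB 0 0; rewrite !subrr.
  by have := cvg_comp _ _ u0 (@qstar_continuous 0); rewrite star0.
have wy0 y : A0 y -> lambda (w ** y) = 0.
  move=> y0; apply: (dense_orthogonal D0_dense) => _ [z z0 <-].
  have lim_wyz := inner_cvg (z := lambda z) (lambda_cvg _ _ _ y0 du_w).
  have lim1 := inner_cvg (z := lambda (delta z)) (lambda_cvg0 _ _ y0 u0).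
  have lim2 := inner_cvg (z := lambda (delta y)) (lambda_cvg0 _ _ z0 us0).
  rewrite inner0l in lim1; rewrite inner0l in lim2.
  have duE n : inner (lambda (delta (u n) ** y)) (lambda z) =
      - (inner (lambda (u n ** y)) (lambda (delta z))
         + (inner (lambda ((u n)^s ** z)) (lambda (delta y)))^*).
    have un := u_core n; rewrite opprD -lambda_delta_skew//; last exact: coreM.
    rewrite deltaM// linearD innerDl -innerC.
    by rewrite (inner_lambda_core_mul (delta y) un z0) addrK.
  apply: (cvg_unique (@norm_hausdorff _ R[i]^o) lim_wyz).
  have duE' := funext duE; rewrite duE'.
  have -> : (0 : R[i]) = - (0 + 0) by rewrite addr0 oppr0.
  apply: cvgN; apply: (cvgD (V := R[i]^o) lim1).
  apply/norm_cvg0P; under eq_fun do rewrite norm_conjC.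
  exact/norm_cvg0P.
apply: contrapT => /faithful[xi [Dxi]]; apply.
apply/eqP; rewrite -normr_le0; apply/ler_addgt0Pr => eps eps0.
have [eta [[_ wxi] [y y0 yE]]] := gns_core_graph_dense gns [:: w] Dxi eps0.
have := wxi w (mem_head _ _); rewrite -yE (gns_act gns)// wy0// sub0r normrN add0r.
exact: ltW.
Qed.

End Derivation.
End GnsCommutator.


Theorem proposition3 (R : realType) (A : completeNormedModType R[i])
    (Q : quasi_star_algebra A) (e : A) (delta : A -> A) (omega : {scalar A})
    (H : hilbert_space R) (D : set H) (pi : A -> operator H)
    (lambda : {linear A -> H})
    (hQ : banach_quasi_star_algebra Q)
    (he : is_unit Q e)
    (hdelta : qu_star_derivation Q delta)
    (homega_rep : representable Q omega)
    (homega_cont : continuous (omega : A -> R[i]^o))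
    (homega_delta : forall x, qcore Q x -> omega (delta x) = 0)
    (hgns : gns_construction Q e omega D pi lambda)
    (hfaithful : faithful_rep D pi) :
  (exists T : operator H,
     [/\ Ldagger (lambda @` qcore Q) T,
         op_eq T (dagger T)
       & forall x, qcore Q x ->
           commutator_defined T (op_restrict (pi x) (lambda @` qcore Q)) /\
           op_eq (op_restrict (pi (delta x)) (lambda @` qcore Q))
                 (op_scale (- 'i)
                    (commutator T (op_restrict (pi x) (lambda @` qcore Q)))) ]) /\
  closable_on (qcore Q) delta.
Proof.
split; last exact: (derivation_closable he hgns hQ homega_cont hdelta).
have [TL TS] := hamiltonian_Ldagger he hgns hdelta homega_delta.
exists (hamiltonian Q lambda delta); split=> // x x0; split.
  exact: (hamiltonian_commutator_defined he hgns hdelta homega_delta).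
exact: (hamiltonian_commutator he hgns hdelta homega_delta).
Qed.
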